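(* Let $R \to S$ be a semicontent algebra, and assume that for any prime ideal $\mathfrak{p}$ of $R$, the localization $R_{\mathfrak p}$ is a fidel (A)-ring (e.g. if $R$ is a locally Noetherian, arithmetical, or zero-dimensional ring, or a $1$-dimensional domain). Then $R \to S$ is residually McCoy.
   Context: All rings are commutative with identity. An element $x$ of a ring is a zero-divisor if $xy=0$ for some nonzero $y$ in the ring. Let $R \to S$ be a ring homomorphism. For $f \in S$, the content $c(f)$ is the intersection of all ideals $I$ of $R$ such that $f \in IS$. The algebra $R \to S$ is called Ohm-Rush if $f \in c(f)S$ for every $f \in S$. A semicontent algebra is a faithfully flat Ohm-Rush algebra $R \to S$ such that for any multiplicative subset $W \subseteq R$ and any $f,g \in S$ with $c(f) \cap W \neq \emptyset$, one has $c(fg)_W = c(g)_W$ (localizations at $W$, as ideals of $W^{-1}R$). An Ohm-Rush algebra $R \to S$ is McCoy if whenever $f,g \in S$ with $fg=0$ and $g \neq 0$, there is some nonzero $r \in R$ with $r\,c(f) = 0$. It is known that if $R \to S$ is Ohm-Rush and $I$ is an ideal of $R$, then $R/I \to S/IS$ is Ohm-Rush. An Ohm-Rush algebra $R \to S$ is residually McCoy if for every ideal $I$ of $R$ the algebra $R/I \to S/IS$ is McCoy (where content is computed with respect to $R/I \to S/IS$). A ring $R$ has property (A) if whenever $J$ is a finitely generated ideal of $R$ consisting of zero-divisors, there is a nonzero $r \in R$ with $J \subseteq \operatorname{ann}(r)$. A ring $R$ has the fidel (A) property (is a fidel (A)-ring) if for every ideal $I$ of $R$, the ring $R/I$ has property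 (A). A ring is locally Noetherian if all its localizations at prime ideals are Noetherian; it is arithmetical if in each of its localizations at prime ideals the ideals are totally ordered by inclusion. *)

(* Defs.v *)
From HB Require Import structures.
From mathcomp Require Import all_boot all_algebra.
From mathcomp Require Import ring generic_quotient.
From mathcomp Require Import boolp classical_sets.

Set Implicit Arguments.
Unset Strict Implicit.
Unset Printing Implicit Defensive.

Import GRing.Theory.
Local Open Scope classical_set_scope.
Local Open Scope ring_scope.
Local Open Scope quotient_scope.

(* Rings are [comPzRingType]s, so the zero ring is allowed; it occurs as [R / I]
   for [I] the unit ideal and as a localization at a set containing [0]. An
   [R]-algebra [S] is given by its structure morphism [phi : {rmorphism R -> S}].
   The ideals of ring_quotient.v are proper and decidable, and its quotients are
   nonzero rings, so arbitrary ideals and their quotients are defined here. *)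

Section Ideals.
Variable R : comPzRingType.

Definition is_ideal (I : set R) : Prop :=
  [/\ I 0, forall x y, I x -> I y -> I (x + y) & forall a x, I x -> I (a * x)].

Record ideal := Ideal {
  ideal_carrier :> R -> Prop;
  idealP : is_ideal (ideal_carrier : set R)
}.

Lemma ideal0 (I : ideal) : I 0.
Proof. by case: (idealP I). Qed.

Lemma idealD (I : ideal) x y : I x -> I y -> I (x + y).
Proof. by case: (idealP I) => _ + _; apply. Qed.

Lemma idealMl (I : ideal) a x : I x -> I (a * x).
Proof. by case: (idealP I) => _ _; apply. Qed.

Lemma idealN (I : ideal) x : I x -> I (- x).
Proof. by move=> Ix; rewrite -mulN1r; apply: idealMl. Qed.

Lemma idealB (I : ideal) x y : I x -> I y -> I (x - y).
Proof. by move=> Ix Iy; apply: idealD => //; apply: idealN. Qed.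

Lemma bigcap_is_ideal T (P : set T) (F : T -> set R) :
  (forall i, P i -> is_ideal (F i)) -> is_ideal (\bigcap_(i in P) F i).
Proof.
move=> FI; split=> [i /FI[]//|x y Fx Fy i Pi|a x Fx i Pi].
  by case: (FI i Pi) => _ + _; apply; [apply: Fx|apply: Fy].
by case: (FI i Pi) => _ _; apply; apply: Fx.
Qed.

Lemma smallest_is_ideal (X : set R) : is_ideal (smallest is_ideal X).
Proof. by apply: (@bigcap_is_ideal _ _ id) => I []. Qed.

Definition ideal_gen (X : set R) : ideal := Ideal (smallest_is_ideal X).

Definition fin_gen (I : ideal) : Prop :=
  exists s : seq R, I = ideal_gen [set` s] :> set R.

Definition is_prime (p : ideal) : Prop :=
  ~ p 1 /\ forall x y, p (x * y) -> p x \/ p y.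

Record prime_ideal := PrimeIdeal {
  prime_carrier :> ideal;
  primeP : is_prime prime_carrier
}.

Definition zero_divisor (x : R) : Prop := exists2 y : R, y != 0 & x * y = 0.

Definition annihilator (r : R) : set R := [set x | x * r = 0].

End Ideals.

Section Quotient.
Variables (R : comPzRingType) (I : ideal R).

Definition ideal_cong : rel R := fun x y => `[< I (x - y) >].

Lemma ideal_cong_refl : reflexive ideal_cong.
Proof. by move=> x; apply/asboolP; rewrite subrr; apply: ideal0. Qed.

Lemma ideal_cong_sym : symmetric ideal_cong.
Proof.
by move=> x y; apply/asboolP/asboolP => /idealN; rewrite opprB.
Qed.

Lemma ideal_cong_trans : transitive ideal_cong.
Proof.
move=> y x z /asboolP Ixy /asboolP Iyz; apply/asboolP.
by rewrite -(subrKA y); apply: idealD.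
Qed.

Canonical ideal_cong_equiv :=
  EquivRel ideal_cong ideal_cong_refl ideal_cong_sym ideal_cong_trans.

Definition quot_ring : Type := {eq_quot ideal_cong}.

HB.instance Definition _ : EqQuotient _ ideal_cong quot_ring :=
  EqQuotient.on quot_ring.
HB.instance Definition _ := Choice.on quot_ring.

Definition quot_proj (x : R) : quot_ring := \pi_quot_ring x.

Lemma quot_projP x y : quot_proj x = quot_proj y <-> I (x - y).
Proof.
split=> [/eqmodP/asboolP//|Ixy].
by apply/eqmodP/asboolP.
Qed.

Lemma quot_projK (a : quot_ring) : quot_proj (repr a) = a.
Proof. exact: reprK. Qed.

Lemma repr_proj x : I (repr (quot_proj x) - x).
Proof. by apply/quot_projP; rewrite quot_projK. Qed.

Definition quot_add (a b : quot_ring) := quot_proj (repr a + repr b).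
Definition quot_opp (a : quot_ring) := quot_proj (- repr a).
Definition quot_mul (a b : quot_ring) := quot_proj (repr a * repr b).

Lemma quot_addE x y :
  quot_add (quot_proj x) (quot_proj y) = quot_proj (x + y).
Proof.
apply/quot_projP; rewrite opprD addrACA.
by apply: idealD; apply: repr_proj.
Qed.

Lemma quot_oppE x : quot_opp (quot_proj x) = quot_proj (- x).
Proof.
by apply/quot_projP; rewrite -opprD; apply/idealN/repr_proj.
Qed.

Lemma quot_mulE x y :
  quot_mul (quot_proj x) (quot_proj y) = quot_proj (x * y).
Proof.
apply/quot_projP; set x' := repr _; set y' := repr _.
have -> : x' * y' - x * y = y' * (x' - x) + x * (y' - y).
  by rewrite !mulrBr (mulrC y' x') (mulrC y' x) subrKA.
by apply: idealD; apply: idealMl; apply: repr_proj.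
Qed.

Lemma quot_ind (P : quot_ring -> Prop) :
  (forall x, P (quot_proj x)) -> forall a, P a.
Proof. by move=> Px a; rewrite -(quot_projK a). Qed.

Fact quot_addA : associative quot_add.
Proof.
elim/quot_ind=> x; elim/quot_ind=> y; elim/quot_ind=> z.
by rewrite !quot_addE addrA.
Qed.

Fact quot_addC : commutative quot_add.
Proof.
by elim/quot_ind=> x; elim/quot_ind=> y; rewrite !quot_addE addrC.
Qed.

Fact quot_add0 : left_id (quot_proj 0) quot_add.
Proof. by elim/quot_ind=> x; rewrite quot_addE add0r. Qed.

Fact quot_addN : left_inverse (quot_proj 0) quot_opp quot_add.
Proof. by elim/quot_ind=> x; rewrite quot_oppE quot_addE addNr. Qed.

HB.instance Definition _ :=
  GRing.isZmodule.Build quot_ring quot_addA quot_addC quot_add0 quot_addN.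

Fact quot_mulA : associative quot_mul.
Proof.
elim/quot_ind=> x; elim/quot_ind=> y; elim/quot_ind=> z.
by rewrite !quot_mulE mulrA.
Qed.

Fact quot_mulC : commutative quot_mul.
Proof.
by elim/quot_ind=> x; elim/quot_ind=> y; rewrite !quot_mulE mulrC.
Qed.

Fact quot_mul1 : left_id (quot_proj 1) quot_mul.
Proof. by elim/quot_ind=> x; rewrite quot_mulE mul1r. Qed.

Fact quot_mulDl : left_distributive quot_mul quot_add.
Proof.
elim/quot_ind=> x; elim/quot_ind=> y; elim/quot_ind=> z.
by rewrite !(quot_mulE, quot_addE) mulrDl.
Qed.

HB.instance Definition _ :=
  GRing.Zmodule_isComPzRing.Build quot_ring
    quot_mulA quot_mulC quot_mul1 quot_mulDl.

Fact quot_proj_is_zmod_morphism : zmod_morphism quot_proj.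
Proof. by move=> x y; rewrite -quot_addE -quot_oppE. Qed.

Fact quot_proj_is_monoid_morphism : monoid_morphism quot_proj.
Proof. by split=> // x y; rewrite -quot_mulE. Qed.

HB.instance Definition _ := GRing.isZmodMorphism.Build R quot_ring quot_proj
  quot_proj_is_zmod_morphism.
HB.instance Definition _ := GRing.isMonoidMorphism.Build R quot_ring quot_proj
  quot_proj_is_monoid_morphism.

End Quotient.

Record mul_set (R : comPzRingType) := MulSet {
  mul_carrier :> R -> Prop;
  mul_set1 : mul_carrier 1;
  mul_setM : forall x y, mul_carrier x -> mul_carrier y -> mul_carrier (x * y)
}.

Section Localization.
Variables (R : comPzRingType) (W : mul_set R).

Definition denoms : Type := {w : R | `[< W w >]}.
HB.instance Definition _ := Choice.on denoms.

Definition denom (w : denoms) : R := val w.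

Lemma denomP (w : denoms) : W (denom w).
Proof. by have /asboolP := valP w. Qed.

Definition Denom (w : R) (Ww : W w) : denoms := exist _ w (asboolT Ww).
Definition denom1 : denoms := Denom (mul_set1 W).
Definition denomM (v w : denoms) : denoms :=
  Denom (mul_setM (denomP v) (denomP w)).

Lemma denom1E : denom denom1 = 1. Proof. by []. Qed.
Lemma denomME v w : denom (denomM v w) = denom v * denom w. Proof. by []. Qed.
Definition denomE := (denom1E, denomME).

Definition frac_eq : rel (R * denoms) := fun x y =>
  `[< exists2 u, W u & u * (x.1 * denom y.2) = u * (y.1 * denom x.2) >].

Lemma frac_eq_refl : reflexive frac_eq.
Proof. by move=> x; apply/asboolP; exists 1 => //; apply: mul_set1. Qed.

Lemma frac_eq_sym : symmetric frac_eq.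
Proof. by move=> x y; apply/asboolP/asboolP => -[u Wu e]; exists u. Qed.

Lemma frac_eq_trans : transitive frac_eq.
Proof.
move=> [b t] [a s] [c r] /asboolP[u Wu /= e] /asboolP[v Wv /= f].
apply/asboolP; exists (u * v * denom t) => /=.
  by apply: mul_setM; [apply: mul_setM|apply: denomP].
transitivity (v * denom r * (u * (a * denom t))); first by ring.
rewrite e; transitivity (u * denom s * (v * (b * denom r))); first by ring.
by rewrite f; ring.
Qed.

Canonical frac_eq_equiv :=
  EquivRel frac_eq frac_eq_refl frac_eq_sym frac_eq_trans.

Definition localization : Type := {eq_quot frac_eq}.

HB.instance Definition _ : EqQuotient _ frac_eq localization :=
  EqQuotient.on localization.
HB.instance Definition _ := Choice.on localization.

Definition mk_frac (a : R) (s : denoms) : localization := \pi_localization (a, s).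

Lemma mk_fracP a s b t :
  mk_frac a s = mk_frac b t <->
  exists2 u, W u & u * (a * denom t) = u * (b * denom s).
Proof. by split=> [/eqmodP/asboolP|e] //; apply/eqmodP/asboolP. Qed.

Lemma mk_frac_repr (x : localization) : mk_frac (repr x).1 (repr x).2 = x.
Proof. by rewrite /mk_frac -surjective_pairing reprK. Qed.

Lemma loc_ind (P : localization -> Prop) :
  (forall a s, P (mk_frac a s)) -> forall x, P x.
Proof. by move=> Pm x; rewrite -(mk_frac_repr x). Qed.

Definition loc_add (x y : localization) : localization :=
  let: (a, s) := repr x in let: (b, t) := repr y in
  mk_frac (a * denom t + b * denom s) (denomM s t).
Definition loc_opp (x : localization) : localization :=
  let: (a, s) := repr x in mk_frac (- a) s.
Definition loc_mul (x y : localization) : localization :=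
  let: (a, s) := repr x in let: (b, t) := repr y in
  mk_frac (a * b) (denomM s t).
Definition loc_map (a : R) : localization := mk_frac a denom1.

Lemma loc_addE a s b t :
  loc_add (mk_frac a s) (mk_frac b t) =
  mk_frac (a * denom t + b * denom s) (denomM s t).
Proof.
rewrite /loc_add; case E: (repr _) => [a' s']; case F: (repr _) => [b' t'].
have /mk_fracP[u Wu e] : mk_frac a' s' = mk_frac a s.
  by rewrite -[RHS]mk_frac_repr E.
have /mk_fracP[v Wv f] : mk_frac b' t' = mk_frac b t.
  by rewrite -[RHS]mk_frac_repr F.
apply/mk_fracP; exists (u * v); first exact: mul_setM.
transitivity (v * denom t' * denom t * (u * (a' * denom s))
            + u * denom s' * denom s * (v * (b' * denom t))); first by rewrite !denomE; ring.
by rewrite e f !denomE; ring.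
Qed.

Lemma loc_oppE a s : loc_opp (mk_frac a s) = mk_frac (- a) s.
Proof.
rewrite /loc_opp; case E: (repr _) => [a' s'].
have /mk_fracP[u Wu e] : mk_frac a' s' = mk_frac a s.
  by rewrite -[RHS]mk_frac_repr E.
by apply/mk_fracP; exists u => //; rewrite !mulNr !mulrN e.
Qed.

Lemma loc_mulE a s b t :
  loc_mul (mk_frac a s) (mk_frac b t) = mk_frac (a * b) (denomM s t).
Proof.
rewrite /loc_mul; case E: (repr _) => [a' s']; case F: (repr _) => [b' t'].
have /mk_fracP[u Wu e] : mk_frac a' s' = mk_frac a s.
  by rewrite -[RHS]mk_frac_repr E.
have /mk_fracP[v Wv f] : mk_frac b' t' = mk_frac b t.
  by rewrite -[RHS]mk_frac_repr F.
apply/mk_fracP; exists (u * v); first exact: mul_setM.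
transitivity ((u * (a' * denom s)) * (v * (b' * denom t))); first by rewrite !denomE; ring.
by rewrite e f !denomE; ring.
Qed.


Lemma mk_frac_eq a s b t : a * denom t = b * denom s -> mk_frac a s = mk_frac b t.
Proof. by move=> e; apply/mk_fracP; exists 1; [apply: mul_set1|rewrite e]. Qed.

Fact loc_addA : associative loc_add.
Proof.
elim/loc_ind=> a s; elim/loc_ind=> b t; elim/loc_ind=> c r.
by rewrite !loc_addE; apply: mk_frac_eq; rewrite !denomE; ring.
Qed.

Fact loc_addC : commutative loc_add.
Proof.
elim/loc_ind=> a s; elim/loc_ind=> b t.
by rewrite !loc_addE; apply: mk_frac_eq; rewrite !denomE; ring.
Qed.

Fact loc_add0 : left_id (loc_map 0) loc_add.
Proof.
elim/loc_ind=> a s.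
by rewrite loc_addE; apply: mk_frac_eq; rewrite !denomE; ring.
Qed.

Fact loc_addN : left_inverse (loc_map 0) loc_opp loc_add.
Proof.
elim/loc_ind=> a s.
by rewrite loc_oppE loc_addE; apply: mk_frac_eq; rewrite !denomE; ring.
Qed.

HB.instance Definition _ :=
  GRing.isZmodule.Build localization loc_addA loc_addC loc_add0 loc_addN.

Fact loc_mulA : associative loc_mul.
Proof.
elim/loc_ind=> a s; elim/loc_ind=> b t; elim/loc_ind=> c r.
by rewrite !loc_mulE; apply: mk_frac_eq; rewrite !denomE; ring.
Qed.

Fact loc_mulC : commutative loc_mul.
Proof.
elim/loc_ind=> a s; elim/loc_ind=> b t.
by rewrite !loc_mulE; apply: mk_frac_eq; rewrite !denomE; ring.
Qed.

Fact loc_mul1 : left_id (loc_map 1) loc_mul.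
Proof.
elim/loc_ind=> a s.
by rewrite loc_mulE; apply: mk_frac_eq; rewrite !denomE; ring.
Qed.

Fact loc_mulDl : left_distributive loc_mul loc_add.
Proof.
elim/loc_ind=> a s; elim/loc_ind=> b t; elim/loc_ind=> c r.
by rewrite !(loc_mulE, loc_addE); apply: mk_frac_eq; rewrite !denomE; ring.
Qed.

HB.instance Definition _ :=
  GRing.Zmodule_isComPzRing.Build localization
    loc_mulA loc_mulC loc_mul1 loc_mulDl.

Fact loc_map_is_zmod_morphism : zmod_morphism loc_map.
Proof.
move=> a b; rewrite [RHS](_ : _ = loc_add (loc_map a) (loc_opp (loc_map b))) //.
by rewrite loc_oppE loc_addE; apply: mk_frac_eq; rewrite !denomE; ring.
Qed.

Fact loc_map_is_monoid_morphism : monoid_morphism loc_map.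
Proof.
split=> // a b; rewrite [RHS](_ : _ = loc_mul (loc_map a) (loc_map b)) //.
by rewrite loc_mulE; apply: mk_frac_eq; rewrite !denomE; ring.
Qed.

HB.instance Definition _ := GRing.isZmodMorphism.Build R localization loc_map
  loc_map_is_zmod_morphism.
HB.instance Definition _ := GRing.isMonoidMorphism.Build R localization loc_map
  loc_map_is_monoid_morphism.

End Localization.

Section LocalizationAtPrime.
Variables (R : comPzRingType) (p : prime_ideal R).

Lemma prime_compl1 : ~ p 1.
Proof. by case: (primeP p). Qed.

Lemma prime_complM x y : ~ p x -> ~ p y -> ~ p (x * y).
Proof. by case: (primeP p) => _ pM px py /pM[]. Qed.

Definition prime_compl : mul_set R :=
  @MulSet R (fun x => ~ p x) prime_compl1 prime_complM.

Definition loc_at : comPzRingType := localization prime_compl.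

End LocalizationAtPrime.

Section Tensor.
Variables (R : comPzRingType) (L M : lmodType R).

(* The list [:: (x1, y1); ...; (xn, yn)] stands for the formal sum of the
   x_i (x) y_i. Opposites are not formal: by [tens_addl] and [tens_zero],
   (- x) (x) y is opposite to x (x) y. *)
Inductive tens_rel : seq (L * M) -> seq (L * M) -> Prop :=
| tens_refl s : tens_rel s s
| tens_sym s t : tens_rel s t -> tens_rel t s
| tens_trans s t u : tens_rel s t -> tens_rel t u -> tens_rel s u
| tens_cat s s' t t' :
    tens_rel s s' -> tens_rel t t' -> tens_rel (s ++ t) (s' ++ t')
| tens_catC s t : tens_rel (s ++ t) (t ++ s)
| tens_zero y : tens_rel [:: (0, y)] [::]
| tens_addl x x' y : tens_rel [:: (x + x', y)] [:: (x, y); (x', y)]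
| tens_addr x y y' : tens_rel [:: (x, y + y')] [:: (x, y); (x, y')]
| tens_scale a x y : tens_rel [:: (a *: x, y)] [:: (x, a *: y)].

Definition tens_eq : rel (seq (L * M)) := fun s t => `[< tens_rel s t >].

Lemma tens_eq_refl : reflexive tens_eq.
Proof. by move=> s; apply/asboolP; apply: tens_refl. Qed.

Lemma tens_eq_sym : symmetric tens_eq.
Proof. by move=> s t; apply/asboolP/asboolP; apply: tens_sym. Qed.

Lemma tens_eq_trans : transitive tens_eq.
Proof.
by move=> t s u /asboolP st /asboolP tu; apply/asboolP/(tens_trans st tu).
Qed.

Canonical tens_eq_equiv :=
  EquivRel tens_eq tens_eq_refl tens_eq_sym tens_eq_trans.

Definition tensor : Type := {eq_quot tens_eq}.

HB.instance Definition _ : EqQuotient _ tens_eq tensor := EqQuotient.on tensor.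
HB.instance Definition _ := Choice.on tensor.

Definition tens_sum (s : seq (L * M)) : tensor := \pi_tensor s.

Lemma tens_sumP s t : tens_sum s = tens_sum t <-> tens_rel s t.
Proof. by split=> [/eqmodP/asboolP|e] //; apply/eqmodP/asboolP. Qed.

Lemma tens_ind (P : tensor -> Prop) :
  (forall s, P (tens_sum s)) -> forall t, P t.
Proof. by move=> Ps t; rewrite -[t]reprK; apply: Ps. Qed.

Lemma tens_repr s : tens_rel (repr (tens_sum s)) s.
Proof. by apply/tens_sumP; exact: reprK. Qed.

Definition opp_terms (s : seq (L * M)) := [seq (- xy.1, xy.2) | xy <- s].

Definition tens_add (t u : tensor) := tens_sum (repr t ++ repr u).
Definition tens_opp (t : tensor) := tens_sum (opp_terms (repr t)).

Lemma tens_addE s t :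
  tens_add (tens_sum s) (tens_sum t) = tens_sum (s ++ t).
Proof. by apply/tens_sumP; apply: tens_cat; apply: tens_repr. Qed.

Lemma opp_terms_rel s t : tens_rel s t -> tens_rel (opp_terms s) (opp_terms t).
Proof.
elim=> {s t} [s|s t _|s t u _ IHs _|s s' t t' _ + _|s t|y|x x' y|x y y'|a x y].
- exact: tens_refl.
- exact: tens_sym.
- exact: tens_trans.
- by rewrite /opp_terms !map_cat; apply: tens_cat.
- by rewrite /opp_terms !map_cat; apply: tens_catC.
- by rewrite /= oppr0; apply: tens_zero.
- by rewrite /= opprD; apply: tens_addl.
- exact: tens_addr.
- by rewrite /= -scalerN; apply: tens_scale.
Qed.

Lemma tens_oppE s : tens_opp (tens_sum s) = tens_sum (opp_terms s).
Proof. by apply/tens_sumP; apply/opp_terms_rel/tens_repr. Qed.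

Fact tens_addA : associative tens_add.
Proof.
elim/tens_ind=> s; elim/tens_ind=> t; elim/tens_ind=> u.
by rewrite !tens_addE catA.
Qed.

Fact tens_addC : commutative tens_add.
Proof.
elim/tens_ind=> s; elim/tens_ind=> t.
by rewrite !tens_addE; apply/tens_sumP/tens_catC.
Qed.

Fact tens_add0 : left_id (tens_sum [::]) tens_add.
Proof. by elim/tens_ind=> s; rewrite tens_addE. Qed.

Fact tens_addN : left_inverse (tens_sum [::]) tens_opp tens_add.
Proof.
elim/tens_ind=> s; rewrite tens_oppE; elim: s => [|[x y] s IHs].
  by rewrite tens_addE.
rewrite -[(x, y) :: s]cat1s /opp_terms map_cat -/(opp_terms s) -!tens_addE.
rewrite [tens_add (tens_sum [:: (x, y)]) _]tens_addC -tens_addA.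
rewrite [tens_add (tens_sum (opp_terms s)) _]tens_addA IHs tens_add0 tens_addE.
apply/tens_sumP/(tens_trans (tens_sym (tens_addl _ _ _))).
by rewrite addNr; apply: tens_zero.
Qed.

HB.instance Definition _ :=
  GRing.isZmodule.Build tensor tens_addA tens_addC tens_add0 tens_addN.

End Tensor.

Section TensorMap.
Variables (R : comPzRingType) (L M N : lmodType R) (f : {linear M -> N}).

Definition map_terms (s : seq (L * M)) : seq (L * N) :=
  [seq (xy.1, f xy.2) | xy <- s].

Definition tens_map (t : tensor L M) : tensor L N :=
  tens_sum (map_terms (repr t)).

Lemma map_terms_rel s t : tens_rel s t -> tens_rel (map_terms s) (map_terms t).
Proof.
elim=> {s t} [s|s t _|s t u _ IHs _|s s' t t' _ + _|s t|y|x x' y|x y y'|a x y].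
- exact: tens_refl.
- exact: tens_sym.
- exact: tens_trans.
- by rewrite /map_terms !map_cat; apply: tens_cat.
- by rewrite /map_terms !map_cat; apply: tens_catC.
- exact: tens_zero.
- exact: tens_addl.
- by rewrite /= linearD; apply: tens_addr.
- by rewrite /= linearZ; apply: tens_scale.
Qed.

Lemma tens_mapE s : tens_map (tens_sum s) = tens_sum (map_terms s).
Proof. by apply/tens_sumP; apply/map_terms_rel/tens_repr. Qed.

End TensorMap.

Definition restr_mod (R S : comPzRingType) (phi : {rmorphism R -> S}) : Type := S.

Section RestrictionOfScalars.
Variables (R S : comPzRingType) (phi : {rmorphism R -> S}).
Local Notation restr_mod := (restr_mod phi).

HB.instance Definition _ := GRing.Zmodule.copy restr_mod S.

Definition restr_scale (a : R) (x : restr_mod) : restr_mod := phi a * (x : S).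

Fact restr_scaleA a b x :
  restr_scale a (restr_scale b x) = restr_scale (a * b) x.
Proof. by rewrite /restr_scale rmorphM mulrA. Qed.

Fact restr_scale1 : left_id 1 restr_scale.
Proof. by move=> x; rewrite /restr_scale rmorph1 mul1r. Qed.

Fact restr_scaleDr : right_distributive restr_scale +%R.
Proof. by move=> a x y; rewrite /restr_scale mulrDr. Qed.

Fact restr_scaleDl x : {morph restr_scale^~ x : a b / a + b}.
Proof. by move=> a b; rewrite /restr_scale rmorphD mulrDl. Qed.

HB.instance Definition _ := GRing.Zmodule_isLmodule.Build R restr_mod
  restr_scaleA restr_scale1 restr_scaleDr restr_scaleDl.

End RestrictionOfScalars.

Definition exact_at (A B : Type) (C : zmodType) (f : A -> B) (g : B -> C) : Prop :=
  range f = g @^-1` [set 0].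

(* Preservation of exactness is flatness, reflection is faithfulness. *)
Definition faithfully_flat (R S : comPzRingType) (phi : {rmorphism R -> S}) : Prop :=
  forall (M1 M2 M3 : lmodType R) (f : {linear M1 -> M2}) (g : {linear M2 -> M3}),
    exact_at f g <->
    exact_at (@tens_map R (restr_mod phi) M1 M2 f)
             (@tens_map R (restr_mod phi) M2 M3 g).

Section Content.
Variables (R S : comPzRingType) (phi : {rmorphism R -> S}).

Definition ideal_ext (I : ideal R) : ideal S := ideal_gen (phi @` I).

Lemma content_is_ideal (f : S) :
  is_ideal (\bigcap_(I in [set I : ideal R | ideal_ext I f]) (I : set R)).
Proof. by apply: bigcap_is_ideal => I _; apply: idealP. Qed.

Definition content (f : S) : ideal R := Ideal (content_is_ideal f).

Definition ohm_rush : Prop := forall f : S, ideal_ext (content f) f.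

End Content.

Definition semicontent (R S : comPzRingType) (phi : {rmorphism R -> S}) : Prop :=
  [/\ faithfully_flat phi,
      ohm_rush phi
    & forall (W : mul_set R) (f g : S),
        (exists2 w, W w & content phi f w) ->
        ideal_ext (loc_map W) (content phi (f * g)) =
        ideal_ext (loc_map W) (content phi g) :> set (localization W)].

Definition mccoy (R S : comPzRingType) (phi : {rmorphism R -> S}) : Prop :=
  ohm_rush phi /\
  forall f g : S, f * g = 0 -> g != 0 ->
    exists2 r : R, r != 0 & forall a, content phi f a -> r * a = 0.

Section QuotientMap.
Variables (R S : comPzRingType) (phi : {rmorphism R -> S}) (I : ideal R).

Definition quot_map (x : quot_ring I) : quot_ring (ideal_ext phi I) :=
  quot_proj (ideal_ext phi I) (phi (repr x)).

Lemma quot_mapE (a : R) :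
  quot_map (quot_proj I a) = quot_proj (ideal_ext phi I) (phi a).
Proof.
apply/quot_projP; rewrite -rmorphB; apply: sub_gen_smallest.
by exists (repr (quot_proj I a) - a) => //; apply: repr_proj.
Qed.

Fact quot_map_is_zmod_morphism : zmod_morphism quot_map.
Proof.
elim/quot_ind=> a; elim/quot_ind=> b.
by rewrite -rmorphB !quot_mapE !rmorphB.
Qed.

Fact quot_map_is_monoid_morphism : monoid_morphism quot_map.
Proof.
split; first by rewrite -(rmorph1 (quot_proj I)) quot_mapE !rmorph1.
elim/quot_ind=> a; elim/quot_ind=> b.
by rewrite -rmorphM !quot_mapE !rmorphM.
Qed.

HB.instance Definition _ := GRing.isZmodMorphism.Build _ _ quot_map
  quot_map_is_zmod_morphism.
HB.instance Definition _ := GRing.isMonoidMorphism.Build _ _ quot_map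
  quot_map_is_monoid_morphism.

End QuotientMap.

Arguments quot_map {R S} phi I x.

Definition residually_mccoy (R S : comPzRingType) (phi : {rmorphism R -> S}) : Prop :=
  ohm_rush phi /\ forall I : ideal R, mccoy (quot_map phi I).

Section RingClasses.
Variable R : comPzRingType.

Definition property_A : Prop :=
  forall J : ideal R, fin_gen J -> (forall x, J x -> zero_divisor x) ->
    exists2 r : R, r != 0 & J `<=` annihilator r.

Definition noetherian : Prop := forall I : ideal R, fin_gen I.

Definition is_domain : Prop :=
  (1 : R) != 0 /\ forall x y : R, x * y = 0 -> x = 0 \/ y = 0.

(* p 0 < ... < p n, strictly; the values of [p] beyond [n] are irrelevant. *)
Definition prime_chain (n : nat) (p : nat -> prime_ideal R) : Prop :=
  forall i, (i < n)%N -> p i `<` p i.+1.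

Definition has_krull_dim (n : nat) : Prop :=
  (exists p, prime_chain n p) /\ ~ (exists p, prime_chain n.+1 p).

End RingClasses.

Definition fidel_A (R : comPzRingType) : Prop :=
  forall I : ideal R, property_A (quot_ring I).

Definition locally_noetherian (R : comPzRingType) : Prop :=
  forall p : prime_ideal R, noetherian (loc_at p).

Definition arithmetical (R : comPzRingType) : Prop :=
  forall (p : prime_ideal R) (I J : ideal (loc_at p)), I `<=` J \/ J `<=` I.

(* Main.v *)
(* Let fg be in IS and g not in IS, so that c(fg) <= I while some b in c(g) is not
   in I, and let p be a prime containing (I : b). For a in c(f), the semicontent
   axiom at W = {u a^n : u not in p} gives u a^n b in I for some u and n; as b is
   not in I_p, a is a zero-divisor on R_p / I_p. Hence the finitely generated ideal
   c(f)_p consists of zero-divisors modulo I_p, and property (A) for R_p / I_p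
   provides an element r of R outside I with r c(f) <= I.

   If dim R = 0, or if R is a one-dimensional domain, every zero-divisor of a
   quotient of R_p is nilpotent: otherwise there would be one prime too many
   strictly inside p. *)

Require Import Defs.
From mathcomp Require Import all_boot all_algebra.
From mathcomp Require Import ring boolp classical_sets.

Set Implicit Arguments.
Unset Strict Implicit.
Unset Printing Implicit Defensive.

Import GRing.Theory.
Local Open Scope classical_set_scope.
Local Open Scope ring_scope.

(** * Zorn's lemma in Tukey's form *)

Section Tukey.
Variables (T : eqType) (Q : seq T -> Prop) (A0 : set T).

Let allQ (A : set T) := forall t : seq T, [set` t] `<=` A -> Q t.

(** Finitely many members of a chain have a largest one, found here by induction on [t]. The first
    alternative covers the empty chain. *)
Lemma chain_cover_finite (F : set (set T)) (t : seq T) :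
  total_on F subset -> [set` t] `<=` \bigcup_(X in F) X `|` A0 ->
  [set` t] `<=` A0 \/ exists2 X, F X & [set` t] `<=` X `|` A0.
Proof.
move=> totF; elim: t => [|x t IHt] sub; first by left.
have xin : x \in x :: t by rewrite mem_head.
have {IHt} IH : [set` t] `<=` A0 \/ exists2 X, F X & [set` t] `<=` X `|` A0.
  by apply: IHt => y /= yt; apply: sub; rewrite /= inE yt orbT.
have cons_sub (Z : set T) : Z x -> [set` t] `<=` Z -> [set` x :: t] `<=` Z.
  by move=> Zx tZ y /=; rewrite inE => /orP[/eqP->//|yt]; apply: tZ.
case: (sub x xin) => [[X FX Xx]|A0x].
  right; case: IH => [tA0|[Y FY tY]].
    by exists X => //; apply: cons_sub; [left|move=> y /tA0; right].
  have [XY|YX] := totF X Y FX FY.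
    by exists Y => //; apply: cons_sub => //; left; apply: XY.
  exists X => //; apply: cons_sub; first by left.
  by move=> y /tY[/YX|]; [left|right].
case: IH => [tA0|[Y FY tY]]; first by left; apply: cons_sub.
by right; exists Y => //; apply: cons_sub => //; right.
Qed.

(** [allQ] has finite character, so it passes to unions of chains and Zorn's lemma applies. *)
Lemma tukey : allQ A0 ->
  exists A, [/\ A0 `<=` A, allQ A & forall B, A `<=` B -> allQ B -> B `<=` A].
Proof.
(* Joining [A0] to every set makes the union of the empty chain admissible, by [Q0], and forces the
   maximal set to contain [A0]. *)
move=> Q0; pose P := [set A | allQ (A `|` A0)].
have [|A [PA maxA]] := @Zorn_bigcup T P.
  move=> F FP totF t /(chain_cover_finite totF)[|[X FX]]; first exact: Q0.
  exact: FP.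
exists (A `|` A0); split=> // B AB QB; have A0B : A0 `<=` B by move=> x A0x; apply: AB; right.
move=> x Bx; left; apply: contrapT => nAx.
apply: (maxA B); first by split=> [y Ay|/(_ x Bx)//]; apply: AB; left.
by move=> t tB; apply: QB => y /tB[|/A0B].
Qed.

End Tukey.

(** * Ideals *)

Section IdealTheory.
Variable R : comPzRingType.
Implicit Types (I J : ideal R) (X : set R).

Lemma mem_ideal_gen X : X `<=` ideal_gen X.
Proof. exact: sub_gen_smallest. Qed.

Lemma ideal_gen_sub X I : X `<=` I -> ideal_gen X `<=` I.
Proof. by move=> XI; apply: smallest_sub => //; apply: idealP. Qed.

Lemma ideal_gen_mono X Y : X `<=` Y -> ideal_gen X `<=` ideal_gen Y.
Proof. by move=> XY; apply: ideal_gen_sub => x /XY; apply: mem_ideal_gen. Qed.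

(** The elements generated by some finite list from [X] already form an ideal containing [X]. *)
Lemma ideal_gen_finite X x : ideal_gen X x ->
  exists2 t : seq R, [set` t] `<=` X & ideal_gen [set` t] x.
Proof.
pose K := [set x | exists2 t : seq R, [set` t] `<=` X & ideal_gen [set` t] x].
suff Kideal : is_ideal K.
  apply: (@ideal_gen_sub X (Ideal Kideal)) => y Xy; exists [:: y].
    by move=> z /=; rewrite inE => /eqP->.
  by apply: mem_ideal_gen => /=; rewrite mem_head.
split=> [|y z [t tX ty] [u uX uz]|a y [t tX ty]].
- by exists [::] => //; apply: ideal0.
- exists (t ++ u).
    by move=> w /=; rewrite mem_cat => /orP[/tX|/uX].
  apply: idealD.
    by apply: ideal_gen_mono ty => w /= wt; rewrite mem_cat wt.
  by apply: ideal_gen_mono uz => w /= wu; rewrite mem_cat wu orbT.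
- by exists t => //; apply: idealMl.
Qed.

Lemma colon_is_ideal I a : is_ideal [set x | I (a * x)].
Proof.
split=> [|x y /= Ix Iy|b x /= Ix]; first by rewrite /= mulr0; apply: ideal0.
  by rewrite mulrDr; apply: idealD.
by rewrite mulrCA; apply: idealMl.
Qed.

Definition colon I a : ideal R := Ideal (colon_is_ideal I a).

Lemma annihilator_is_ideal (r : R) : is_ideal (annihilator r).
Proof.
split=> [|x y xr yr|a x xr]; rewrite /annihilator /=; first exact: mul0r.
  by rewrite mulrDl xr yr addr0.
by rewrite -mulrA xr mulr0.
Qed.

Definition ann (r : R) : ideal R := Ideal (annihilator_is_ideal r).

Lemma ideal_gen_setU1 I a x : ideal_gen (a |` I) x ->
  exists b, I (x - b * a).
Proof.
suff Kideal : is_ideal [set x | exists b, I (x - b * a)].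
  apply: (@ideal_gen_sub _ (Ideal Kideal)) => y [->|Iy].
    by exists 1; rewrite mul1r subrr; apply: ideal0.
  by exists 0; rewrite mul0r subr0.
split=> [|y z [b yb] [c zc]|b y [c yc]].
- by exists 0; rewrite mul0r subr0; apply: ideal0.
- by exists (b + c); rewrite mulrDl opprD addrACA; apply: idealD.
- by exists (b * c); rewrite -mulrA -mulrBr; apply: idealMl.
Qed.

(** An ideal maximal among those that contain [I] and miss [W] is prime. Missing [W] is tested on
    finite lists of generators, which gives access to [tukey]. *)
Lemma exists_prime_disjoint I (W : mul_set R) : (forall x, I x -> ~ W x) ->
  exists p : prime_ideal R, I `<=` p /\ forall x, p x -> ~ W x.
Proof.
move=> IW; pose Q (t : seq R) := forall x, ideal_gen [set` t] x -> ~ W x.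
have [t tI x tx|A [IA QA maxA]] := @tukey _ Q I.
  by apply: IW; apply: ideal_gen_sub tx.
have AW x : ideal_gen A x -> ~ W x.
  by move=> /ideal_gen_finite[t tA tx]; apply: (QA t).
have gA x : ideal_gen A x -> A x.
  move=> gx; apply: (maxA (ideal_gen A)) => // [|t tA y ty].
    exact: mem_ideal_gen.
  by apply: AW; apply: ideal_gen_sub ty.
(* By maximality, adjoining [x] to [A] yields an ideal that meets [W], at some [w] congruent to a
   multiple of [x]. *)
have notA x : ~ ideal_gen A x -> exists w a, W w /\ ideal_gen A (w - a * x).
  move=> nAx; apply: contrapT => noW; apply: nAx.
  pose B : set R := x |` ideal_gen A.
  have AB : A `<=` B by move=> y Ay; right; apply: mem_ideal_gen.
  have QB (t : seq R) : [set` t] `<=` B -> Q t.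
    move=> tB y ty Wy; apply: noW.
    have tgB : [set` t] `<=` ideal_gen B by move=> z /tB; apply: mem_ideal_gen.
    have /ideal_gen_setU1[a Aa] := ideal_gen_sub tgB ty.
    by exists y, a.
  by apply: mem_ideal_gen; apply: (maxA B AB QB x); left.
have prA : is_prime (ideal_gen A).
  split=> [/AW|x y Axy]; first by apply; apply: mul_set1.
  apply: contrapT => /not_orP[/notA[w [a [Ww Aw]]] /notA[v [b [Wv Av]]]].
  apply: (AW (w * v)); last exact: mul_setM.
  have -> : w * v = v * (w - a * x) + (a * x) * (v - b * y) + (a * b) * (x * y).
    by ring.
  by apply: idealD; [apply: idealD|]; apply: idealMl.
exists (PrimeIdeal prA); split=> // x /IA; apply: mem_ideal_gen.
Qed.

End IdealTheory.

(** Under a surjection the image of an ideal is an ideal. *)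
Lemma ideal_gen_image_surj (R A : comPzRingType) (h : {rmorphism R -> A})
    (X : set R) (y : A) :
  (forall y, exists x, h x = y) -> ideal_gen (h @` X) y ->
  exists2 x, ideal_gen X x & h x = y.
Proof.
move=> hsurj; have Kideal : is_ideal (h @` (ideal_gen X : set R)).
  split=> [|_ _ [x Xx <-] [z Xz <-]|b _ [x Xx <-]].
  - by exists 0; [apply: ideal0|rewrite rmorph0].
  - by exists (x + z); [apply: idealD|rewrite rmorphD].
  - have [a <-] := hsurj b; exists (a * x); last by rewrite rmorphM.
    exact: idealMl.
apply: (@ideal_gen_sub _ _ (Ideal Kideal)) => _ [x Xx <-].
by exists x => //; apply: mem_ideal_gen.
Qed.

Lemma preimage_is_ideal (R A : comPzRingType) (h : {rmorphism R -> A})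
    (K : ideal A) : is_ideal [set x | K (h x)].
Proof.
split=> [|x y Kx Ky|a x Kx] /=; rewrite ?(rmorph0, rmorphD, rmorphM).
- exact: ideal0.
- exact: idealD.
- exact: idealMl.
Qed.

Definition preim_ideal (R A : comPzRingType) (h : {rmorphism R -> A})
  (K : ideal A) : ideal R := Ideal (preimage_is_ideal h K).

Lemma quot_proj_eq0 (R : comPzRingType) (I : ideal R) x :
  quot_proj I x = 0 <-> I x.
Proof. by rewrite -(rmorph0 (quot_proj I)) quot_projP subr0. Qed.

Lemma quot_proj_surj (R : comPzRingType) (I : ideal R) (y : quot_ring I) :
  exists x, quot_proj I x = y.
Proof. by exists (repr y); apply: quot_projK. Qed.

(** * Localization *)

Section LocalizationTheory.
Variables (R : comPzRingType) (W : mul_set R).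

Lemma mk_fracM (a b : R) (s t : denoms W) :
  mk_frac a s * mk_frac b t = mk_frac (a * b) (denomM s t).
Proof. exact: loc_mulE. Qed.

Lemma mk_frac_loc (a : R) (s : denoms W) :
  mk_frac a s = mk_frac 1 s * loc_map W a.
Proof. by rewrite mk_fracM; apply: mk_frac_eq; rewrite !denomE; ring. Qed.

Lemma loc_mk_frac (a : R) (s : denoms W) :
  loc_map W a = loc_map W (denom s) * mk_frac a s.
Proof. by rewrite mk_fracM; apply: mk_frac_eq; rewrite !denomE; ring. Qed.

Lemma ideal_mk_frac (K : ideal (localization W)) (a : R) (s : denoms W) :
  K (mk_frac a s) <-> K (loc_map W a).
Proof.
by split=> Ka; [rewrite (loc_mk_frac a s)|rewrite mk_frac_loc];
  apply: idealMl.
Qed.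

Lemma ideal_loc_map_mul (K : ideal (localization W)) (u a : R) :
  W u -> K (loc_map W (u * a)) -> K (loc_map W a).
Proof.
move=> Wu Kua.
suff -> : loc_map W a = mk_frac 1 (Denom Wu) * loc_map W (u * a).
  exact: idealMl.
by rewrite mk_fracM; apply: mk_frac_eq; rewrite !denomE /= /denom /=; ring.
Qed.

(** Sums can be brought to a common denominator, so fractions with numerator in the generated ideal
    form an ideal. *)
Lemma ideal_gen_loc_map (X : set R) (y : localization W) :
  ideal_gen (loc_map W @` X) y ->
  exists a s, ideal_gen X a /\ y = mk_frac a s.
Proof.
suff Kideal : is_ideal [set y : localization W |
    exists a s, ideal_gen X a /\ y = mk_frac a s].
  apply: (@ideal_gen_sub _ _ (Ideal Kideal)) => _ [a Xa <-].
  by exists a, (denom1 W); split=> //; apply: mem_ideal_gen.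
split=> [|_ _ [b [s [Ib ->]]] [c [t [Ic ->]]]|x _ [b [s [Ib ->]]]].
- by exists 0, (denom1 W); split=> //; apply: ideal0.
- exists (b * denom t + c * denom s), (denomM s t); split.
    by apply: idealD; rewrite mulrC; apply: idealMl.
  exact: loc_addE.
- elim/loc_ind: x => c t; exists (c * b), (denomM t s); split.
    exact: idealMl.
  exact: mk_fracM.
Qed.

(** The contraction of the extension of [I] is its saturation with respect to [W]. *)
Lemma ideal_ext_loc_map (I : ideal R) (a : R) :
  ideal_ext (loc_map W) I (loc_map W a) <-> exists2 u, W u & I (u * a).
Proof.
split=> [/ideal_gen_loc_map[b [s [gb /mk_fracP[u Wu e]]]]|[u Wu Iua]].
  have Ib : I b by apply: (ideal_gen_sub _ gb).
  exists (u * denom s); first by apply: mul_setM => //; apply: denomP.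
  rewrite -mulrA [_ * a]mulrC e.
  by apply: idealMl; rewrite mulrC; apply: idealMl.
by apply: (ideal_loc_map_mul Wu); apply: mem_ideal_gen; exists (u * a).
Qed.

End LocalizationTheory.

(** * Property (A) *)

Section PropertyA.
Variable R : comPzRingType.

Lemma property_A_seq :
  (forall s : seq R, (forall x, ideal_gen [set` s] x -> zero_divisor x) ->
     exists2 r : R, r != 0 & forall x, x \in s -> x * r = 0) ->
  property_A R.
Proof.
move=> H J [s Js]; rewrite Js => zJ.
have [r r0 sr] := H s zJ; exists r => //.
exact: (@ideal_gen_sub _ _ (ann r)).
Qed.

(** The annihilated element is built one generator at a time: if [r] is killed by the earlier ones,
    multiply it by the highest power of [x] that does not kill it. *)
Lemma property_A_nilpotent :
  (forall x : R, zero_divisor x -> exists n, x ^+ n = 0) -> property_A R.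
Proof.
move=> nil; apply: property_A_seq => s zs.
(* That 0 is a zero-divisor provides a nonzero element, the witness for the empty list. *)
have [y0 y00 _] : zero_divisor (0 : R) by apply: zs; apply: ideal0.
have {zs} : {in s, forall x, exists n, x ^+ n = 0}.
  by move=> x xs; apply: nil; apply: zs; apply: mem_ideal_gen.
elim: s => [|x s IHs] nils; first by exists y0.
have [|r r0 sr] := IHs; first by move=> z zs; apply: nils; rewrite inE zs orbT.
have [n xn] := nils x (mem_head _ _).
have : exists n, x ^+ n * r == 0 by exists n; rewrite xn mul0r.
case/ex_minnP=> -[|m]; first by rewrite mul1r (negPf r0).
move=> /eqP xm minm; exists (x ^+ m * r).
  by apply/negP => /minm; rewrite ltnn.
move=> z; rewrite inE => /orP[/eqP->|zs]; first by rewrite mulrA -exprS.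
by rewrite mulrCA sr // mulr0.
Qed.

(** Finitely generated ideals are principal here, so an element killed by a single zero-divisor is
    killed by the whole ideal. *)
Lemma property_A_chain :
  (forall I J : ideal R, I `<=` J \/ J `<=` I) -> property_A R.
Proof.
move=> tot; apply: property_A_seq => s zs.
have [y0 y00 _] : zero_divisor (0 : R) by apply: zs; apply: ideal0.
suff [x sx xs] : exists2 x, ideal_gen [set` s] x &
    [set` s] `<=` ideal_gen [set x].
  have [r r0 xr] := zs x sx; exists r => // y /xs.
  by apply: (@ideal_gen_sub _ _ (ann r)) => _ ->.
elim: s {zs} => [|x s [z sz zs]].
  by exists 0; [apply: ideal0|].
have sub : ideal_gen [set` s] `<=` ideal_gen [set` x :: s].
  by apply: ideal_gen_mono => y /= ys; rewrite inE ys orbT.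
have [xz|zx] := tot (ideal_gen [set x]) (ideal_gen [set z]).
  exists z; first exact: sub.
  move=> y /=; rewrite inE => /orP[/eqP->|/zs//].
  by apply: xz; apply: mem_ideal_gen.
exists x; first by apply: mem_ideal_gen; rewrite /= mem_head.
move=> y /=; rewrite inE => /orP[/eqP->|/zs /zx//].
exact: mem_ideal_gen.
Qed.

(** Multiply an element of [J] outside [p] by one element of each [P i] outside [p]; the product
    stays outside the prime [p]. *)
Lemma exists_avoid_prime_mem (T : eqType) (P : T -> prime_ideal R)
    (s : seq T) (J : ideal R) (p : prime_ideal R) :
  ~ J `<=` p -> {in s, forall i, ~ P i `<=` p} ->
  exists x, [/\ J x, ~ p x & {in s, forall i, P i x}].
Proof.
move=> /existsNP[y /not_implyP[Jy py]].
elim: s => [|i s IHs] nsub; first by exists y.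
have [|x [Jx px sx]] := IHs; first by move=> j js; apply: nsub; rewrite inE js orbT.
have /existsNP[z /not_implyP[Pz pz]] := nsub i (mem_head _ _).
exists (z * x); split; first exact: idealMl.
  exact: prime_complM.
move=> j; rewrite inE => /orP[/eqP->|js]; first by rewrite mulrC; apply: idealMl.
by apply: idealMl; apply: sx.
Qed.

Lemma prime_avoidance (T : eqType) (P : T -> prime_ideal R) (s : seq T)
    (J : ideal R) :
  {in s, forall i, ~ J `<=` P i} ->
  exists2 x, J x & {in s, forall i, ~ P i x}.
Proof.
have [n] := ubnP (size s); elim: n s => // n IHn [|i s] /ltnSE sz nsub.
  by exists 0; first exact: ideal0.
have nsub_s : {in s, forall j, ~ J `<=` P j}.
  by move=> j js; apply: nsub; rewrite inE js orbT.
have [[j js ji]|indep] := pselect (exists2 j, j \in s & P j `<=` P i).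
  case/splitPr: js sz nsub nsub_s => s1 s2 sz nsub _.
  have sub : {subset i :: s1 ++ s2 <= i :: s1 ++ j :: s2}.
    by move=> k; rewrite !inE !mem_cat inE => /or3P[]->; rewrite ?orbT.
  have [||x Jx xs] := IHn (i :: s1 ++ s2).
  - by move: sz; rewrite /= !size_cat /= addnS.
  - by move=> k /sub; apply: nsub.
  exists x => // k; rewrite !inE mem_cat inE => /or4P[/eqP->|k1|/eqP->|k2].
  - by apply: xs; rewrite mem_head.
  - by apply: xs; rewrite inE mem_cat k1 orbT.
  - by move=> /ji; apply: xs; rewrite mem_head.
  - by apply: xs; rewrite inE mem_cat k2 !orbT.
have [x Jx xs] := IHn s sz nsub_s.
have [Px|nPx] := pselect (P i x); last first.
  by exists x => // k; rewrite inE => /orP[/eqP->//|]; apply: xs.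
have [||y [Jy Py ys]] := @exists_avoid_prime_mem _ P s J (P i).
- exact/nsub/mem_head.
- by move=> j js ji; apply: indep; exists j.
exists (x + y); first exact: idealD.
move=> k; rewrite inE => /orP[/eqP-> Pxy|ks Pxy].
  by apply: Py; rewrite -[y](addKr x) addrC; apply: idealB.
by apply: (xs k ks); rewrite -[x](addrK y); apply: idealB => //; apply: ys.
Qed.

(** * Maximal annihilators and Noetherian rings *)

Definition max_ann (x : R) : Prop :=
  x != 0 /\ forall y, y != 0 -> ann x `<=` ann y -> ann y `<=` ann x.

(** If [a * x] is nonzero, maximality gives [ann (a * x)] = [ann x], and [b] lies in the former. *)
Lemma max_ann_prime x : max_ann x -> is_prime (ann x).
Proof.
move=> [x0 maxx]; split=> [/=|a b /= abx].
  by rewrite /annihilator /= mul1r; apply/eqP.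
have [ax|/eqP ax] := pselect (a * x = 0); first by left.
right; apply: (maxx (a * x)) => //; rewrite /= /annihilator /=.
  by move=> c /= cx; rewrite mulrCA cx mulr0.
by rewrite mulrCA mulrA.
Qed.

(** Finite generation alone may give generators outside [X]; each of them is in turn generated by
    finitely many elements of [X]. *)
Lemma noetherian_fin_subset (X : set R) : noetherian R ->
  exists2 t : seq R, [set` t] `<=` X & X `<=` ideal_gen [set` t].
Proof.
move=> /(_ (ideal_gen X))[s Xs].
suff [t tX st] : exists2 t : seq R, [set` t] `<=` X &
    [set` s] `<=` ideal_gen [set` t].
  exists t => // x /mem_ideal_gen; rewrite Xs.
  exact: ideal_gen_sub.
have : [set` s] `<=` ideal_gen X by rewrite Xs; apply: mem_ideal_gen.
elim: s {Xs} => [|x s IHs] sX; first by exists [::].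
have [|t tX st] := IHs; first by move=> y /= ys; apply: sX; rewrite /= inE ys orbT.
have /ideal_gen_finite[u uX ux] : ideal_gen X x by apply: sX; rewrite /= mem_head.
exists (t ++ u) => [y /=|y /=]; first by rewrite mem_cat => /orP[/tX|/uX].
rewrite inE => /orP[/eqP->|/st].
  by apply: ideal_gen_mono ux => z /= zu; rewrite mem_cat zu orbT.
by apply: ideal_gen_mono => z /= zt; rewrite mem_cat zt.
Qed.

(** Take [A] containing [ann y] and maximal such that each finite part of it kills a common nonzero
    element. As [A] lies in the ideal generated by one such part, it kills a single [x], and
    maximality makes it [ann x]. *)
Lemma noetherian_max_ann y : noetherian R -> y != 0 ->
  exists2 x, max_ann x & ann y `<=` ann x.
Proof.
move=> noeth y0; pose Q (t : seq R) := exists2 x, x != 0 & [set` t] `<=` ann x.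
have [t ty|A [yA QA maxA]] := @tukey _ Q (ann y); first by exists y.
have [t tA At] := noetherian_fin_subset A noeth.
have [x x0 tx] := QA t tA.
have Ax : A `<=` ann x by move=> a /At; apply: ideal_gen_sub.
exists x; last by move=> a /yA /Ax.
split=> // z z0 xz; suff zA : ann z `<=` A by move=> a /zA /Ax.
by apply: maxA => [a /Ax /xz//|u uz]; exists z.
Qed.

(* The maximal annihilators of nonzero elements are prime; being Noetherian,
   [R] has finitely many elements [t] with such annihilators generating all the
   others, so the zero-divisors are covered by the annihilators of [t]. *)
Lemma property_A_noetherian : noetherian R -> property_A R.
Proof.
move=> noeth J _ zJ.
have [t tmax maxt] := noetherian_fin_subset max_ann noeth.
have [//|noJ] := pselect (exists2 r : R, r != 0 & J `<=` annihilator r).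
(* The index is a subtype because only members of [t] are known to have prime annihilators;
   [pmap insub t] lists them. *)
pose P (i : {x | x \in t}) := PrimeIdeal (max_ann_prime (tmax _ (valP i))).
have [|x Jx xt] := @prime_avoidance _ P (pmap insub t) J.
  move=> i _ Ji; apply: noJ; exists (val i) => //.
  by case: (tmax _ (valP i)).
have [y y0 xy] := zJ x Jx.
have [z zmax yz] := noetherian_max_ann noeth y0.
have xz : x * z = 0 by apply: (yz x).
have [z0 maxz] := zmax.
(* If [ann z] contained the annihilator of a member of [t], maximality would make the two equal, and
   [x], which kills [z], would lie in [P i]. *)
have tz i : ~ P i `<=` ann z.
  move=> iz; apply: (xt i); first by rewrite mem_pmap_sub //; apply: valP.
  by case: (tmax _ (valP i)) => _ maxi; apply: (maxi z).
(* With [ann 0] as the unit ideal, this gives [c] that kills all of [t] but not [z], although [t]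
   generates [z]. *)
have [||c [_ cz ct]] :=
  @exists_avoid_prime_mem _ P (pmap insub t) (ann 0) (PrimeIdeal (max_ann_prime zmax)).
- by move=> /(_ 1); rewrite /= /annihilator /= mulr0 mul1r => /(_ erefl)/eqP; apply/negP.
- by move=> i _; apply: tz.
case: cz; rewrite /= /annihilator /= mulrC.
apply: (@ideal_gen_sub _ _ (ann c) _ _ (maxt z zmax)) => i ti.
rewrite /= /annihilator /= mulrC; apply: (ct (exist _ i ti)).
by rewrite mem_pmap_sub.
Qed.

End PropertyA.

(** * Noetherian and chain rings are fidel (A) *)

Section FidelA.
Variable R : comPzRingType.

Lemma noetherian_quot (I : ideal R) : noetherian R -> noetherian (quot_ring I).
Proof.
move=> noeth J; have [s Js] := noeth (preim_ideal (quot_proj I) J).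
exists (map (quot_proj I) s); apply/seteqP; split.
  elim/quot_ind=> x Jx; have : preim_ideal (quot_proj I) J x by [].
  rewrite Js; apply: (@ideal_gen_sub _ _ (preim_ideal (quot_proj I) (ideal_gen _))).
  by move=> y ys; apply: mem_ideal_gen; apply: map_f.
apply: ideal_gen_sub => _ /mapP[x xs ->].
suff: preim_ideal (quot_proj I) J x by [].
by rewrite Js; apply: mem_ideal_gen.
Qed.

Lemma fidel_A_noetherian : noetherian R -> fidel_A R.
Proof. by move=> noeth I; apply/property_A_noetherian/noetherian_quot. Qed.

Lemma fidel_A_chain :
  (forall I J : ideal R, I `<=` J \/ J `<=` I) -> fidel_A R.
Proof.
move=> tot I; apply: property_A_chain => J K.
by have [JK|KJ] := tot (preim_ideal (quot_proj I) J) (preim_ideal (quot_proj I) K);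
  [left|right]; elim/quot_ind => x; [apply: JK|apply: KJ].
Qed.

End FidelA.

(** * Primes and zero-divisors of localizations *)

Section MulPowers.
Variables (R : comPzRingType) (p : prime_ideal R) (a : R).

(** Localizing at this set inverts [a] in the local ring at [p]. *)
Definition powers_away : R -> Prop := fun x => exists u n, ~ p u /\ x = u * a ^+ n.

Lemma powers_away1 : powers_away 1.
Proof. by exists 1, 0%N; rewrite mulr1; split=> //; apply: prime_compl1. Qed.

Lemma powers_awayM x y : powers_away x -> powers_away y -> powers_away (x * y).
Proof.
move=> [u [n [pu ->]]] [v [m [pv ->]]]; exists (u * v), (n + m)%N.
by split; [apply: prime_complM|rewrite exprD mulrACA].
Qed.

Definition powers_away_set : mul_set R := MulSet powers_away1 powers_awayM.

Lemma powers_away_compl x : ~ p x -> powers_away x.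
Proof. by move=> px; exists x, 0%N; rewrite mulr1. Qed.

Lemma powers_away_mem : powers_away a.
Proof. by exists 1, 1%N; rewrite mul1r; split=> //; apply: prime_compl1. Qed.

End MulPowers.

Section LocalQuotient.
Variables (R : comPzRingType) (p : prime_ideal R) (K : ideal (loc_at p)).

Lemma quot_loc_ind (P : quot_ring K -> Prop) :
  (forall a s, P (quot_proj K (mk_frac a s))) -> forall x, P x.
Proof. by move=> H; elim/quot_ind; elim/loc_ind. Qed.

Lemma quot_loc_eq0 a s :
  quot_proj K (mk_frac a s) = 0 <-> K (loc_map (prime_compl p) a).
Proof. by rewrite quot_proj_eq0 ideal_mk_frac. Qed.

Lemma zero_divisor_quot_loc_mem a s :
  zero_divisor (quot_proj K (mk_frac a s)) -> p a.
Proof.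
case=> y /eqP y0 axy; apply: contrapT => pa; apply: y0; move: y axy.
elim/quot_loc_ind=> b t; rewrite -rmorphM mk_fracM quot_loc_eq0.
by move=> /(@ideal_loc_map_mul _ (prime_compl p) _ _ _ pa) Kb; apply/quot_loc_eq0.
Qed.

(* If [x] is the class of a/s with [a] in [p], the prime is one avoiding
   all u a^n with [u] outside [p]. *)
Lemma zero_divisor_quot_loc_nilpotent (x : quot_ring K) : zero_divisor x ->
  (exists n, x ^+ n = 0) \/
  exists2 q : prime_ideal R, preim_ideal (loc_map (prime_compl p)) K `<=` q
    & q `<` p.
Proof.
elim/quot_loc_ind: x => a s /zero_divisor_quot_loc_mem pa.
have [[n Kn]|nil] := pselect (exists n, K (loc_map (prime_compl p) (a ^+ n))).
  left; exists n; rewrite -rmorphXn; apply/quot_proj_eq0.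
  by rewrite mk_frac_loc exprMn -rmorphXn; apply: idealMl.
right; have [|q [Kq qW]] := @exists_prime_disjoint _
    (preim_ideal (loc_map (prime_compl p)) K) (powers_away_set p a).
  move=> x Kx [u [n [pu xE]]]; apply: nil; exists n.
  by apply: (@ideal_loc_map_mul _ (prime_compl p) _ _ _ pu); rewrite -xE.
(* The avoided set contains the complement of [p], so [q] lies in [p]; it also contains [a], which
   is in [p], so the inclusion is strict. *)
exists q => //; split=> [x qx|/(_ a pa)/qW].
  by apply: contrapT => /(powers_away_compl a); apply: qW.
by apply; apply: powers_away_mem.
Qed.

End LocalQuotient.

(** * Dimension zero and one-dimensional domains *)

Section KrullDim.
Variable R : comPzRingType.

Lemma fidel_A_dim0 (p : prime_ideal R) : has_krull_dim R 0 -> fidel_A (loc_at p).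
Proof.
move=> [_ no1] K; apply: property_A_nilpotent => x.
move=> /zero_divisor_quot_loc_nilpotent[//|[q _ qp]].
case: no1; exists (fun i => if i is 0 then q else p) => i.
by rewrite ltnS leqn0 => /eqP->.
Qed.

Lemma zero_is_ideal : is_ideal [set 0 : R].
Proof.
by split=> [//|_ _ -> ->|a _ ->] /=; rewrite ?addr0 ?mulr0.
Qed.

Lemma domain_zero_prime : is_domain R -> is_prime (Ideal zero_is_ideal).
Proof. by move=> [/eqP one_neq0 dom]; split. Qed.

Lemma fidel_A_domain_dim1 (p : prime_ideal R) :
  is_domain R -> has_krull_dim R 1 -> fidel_A (loc_at p).
Proof.
move=> dom [_ no2] K; apply: property_A_nilpotent => x zx.
have [//|[q Kq qp]] := zero_divisor_quot_loc_nilpotent zx.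
(* A nonzero [b] in the contraction of [K] lies in [q], so the zero ideal, [q] and [p] would form a
   chain of three primes. *)
have {q Kq qp} K0 b : K (loc_map (prime_compl p) b) -> b = 0.
  move=> Kb; apply: contrapT => b0; apply: no2.
  exists (fun i => match i with
    | 0 => PrimeIdeal (domain_zero_prime dom) | 1 => q | _ => p end).
  case=> [_|[_|//]] //; split=> [_ ->|/(_ b (Kq b Kb))//].
  exact: ideal0.
(* Since [K] contracts to zero and the ring is a domain, the zero-divisor [x] is itself zero. *)
exists 1%N; case: zx => y; rewrite expr1.
elim/quot_loc_ind: x => a s; elim/quot_loc_ind: y => b t y0.
rewrite -rmorphM mk_fracM quot_loc_eq0 => /K0.
case: dom => _ dom /dom[->|b0]; first by apply/quot_loc_eq0; rewrite rmorph0; apply: ideal0.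
by case/eqP: y0; apply/quot_loc_eq0; rewrite b0 rmorph0; apply: ideal0.
Qed.

End KrullDim.

(** * Content *)

Section ContentTheory.
Variables (R S : comPzRingType) (phi : {rmorphism R -> S}).

Lemma ideal_ext_mono (I J : ideal R) :
  I `<=` J -> ideal_ext phi I `<=` ideal_ext phi J.
Proof. by move=> IJ; apply: ideal_gen_mono => _ [x /IJ Jx <-]; exists x. Qed.

Lemma content_sub (I : ideal R) f : ideal_ext phi I f -> content phi f `<=` I.
Proof. by move=> If x; apply. Qed.

(** Writing [f] as an element of c(f)S involves only finitely many elements of c(f). They generate
    an ideal whose extension contains [f], hence all of c(f) by minimality. *)
Lemma content_fin_gen f : ohm_rush phi -> fin_gen (content phi f).
Proof.
move=> /(_ f)/ideal_gen_finite[t tc tf].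
have [s sc st] : exists2 s : seq R, [set` s] `<=` content phi f &
    [set` t] `<=` phi @` [set` s].
  elim: t tc {tf} => [|y t IHt] tc; first by exists [::].
  have [|s sc st] := IHt; first by move=> z /= zt; apply: tc; rewrite /= inE zt orbT.
  have [x cx xy] := tc y (mem_head _ _).
  exists (x :: s) => z /=; rewrite inE => /orP[/eqP->|]; first by [].
  - exact: sc.
  - by exists x; rewrite //= mem_head.
  - by move=> /st[w ws <-]; exists w; rewrite //= inE ws orbT.
exists s; apply/seteqP; split; last exact: ideal_gen_sub.
apply: content_sub; apply: (ideal_gen_sub _ tf) => y /st[x xs <-].
by apply: mem_ideal_gen; exists x => //; apply: mem_ideal_gen.
Qed.

Variable I : ideal R.

(** The preimage of [J] contains [I], so its extension contains IS and does not depend on the lift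
    chosen for the class of [f]. *)
Lemma ideal_ext_quot_map (J : ideal (quot_ring I)) f :
  ideal_ext (quot_map phi I) J (quot_proj _ f) <->
  ideal_ext phi (preim_ideal (quot_proj I) J) f.
Proof.
split; last first.
  apply: (@ideal_gen_sub _ _
    (preim_ideal (quot_proj _) (ideal_ext (quot_map phi I) J))).
  move=> _ [x Jx <-]; apply: mem_ideal_gen; exists (quot_proj I x) => //.
  exact: quot_mapE.
pose E := ideal_ext phi (preim_ideal (quot_proj I) J).
have IE : ideal_ext phi I `<=` E.
  apply: ideal_ext_mono => x /quot_proj_eq0 x0.
  by rewrite /= x0; apply: ideal0.
have sub : quot_map phi I @` J `<=` quot_proj (ideal_ext phi I) @` E.
  move=> _ [x + <-]; elim/quot_ind: x => x Jx.
  exists (phi x); last by rewrite quot_mapE.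
  by apply: mem_ideal_gen; exists x.
move=> /(ideal_gen_mono sub)/ideal_gen_image_surj[|g Eg gf].
  exact: quot_proj_surj.
have {}Eg : E g by apply: (ideal_gen_sub _ Eg).
move/quot_projP: gf => /IE fg.
by rewrite -[f](subKr g); apply: idealB.
Qed.

(** The image of c(f) is an ideal whose extension contains the class of [f], so it contains the
    content of that class. *)
Lemma content_quot_map f x : ohm_rush phi ->
  content (quot_map phi I) (quot_proj _ f) x ->
  exists2 a, content phi f a & quot_proj I a = x.
Proof.
move=> OR; have [y ->] : exists y, x = quot_proj I y.
  by have [y <-] := quot_proj_surj x; exists y.
have surj := @quot_proj_surj _ I.
move=> /(_ (ideal_gen (quot_proj I @` content phi f))) cy.
have /(ideal_gen_image_surj surj)[a ca ay] :
    ideal_gen (quot_proj I @` content phi f) (quot_proj I y).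
  apply: cy; apply/ideal_ext_quot_map.
  apply: (ideal_ext_mono _ (OR f)) => a ca.
  by apply: mem_ideal_gen; exists a.
by exists a => //; apply: (ideal_gen_sub _ ca).
Qed.

Lemma ohm_rush_quot : ohm_rush phi -> ohm_rush (quot_map phi I).
Proof.
move=> OR; elim/quot_ind=> f; apply/ideal_ext_quot_map.
apply: (ideal_ext_mono _ (OR f)) => a ca J /ideal_ext_quot_map /content_sub.
exact.
Qed.

Lemma ohm_rush_mem_ext f : ohm_rush phi ->
  content phi f `<=` I -> ideal_ext phi I f.
Proof. by move=> OR fI; apply: (ideal_ext_mono fI). Qed.

End ContentTheory.

(** * The McCoy property *)

Fact one_setM (R : comPzRingType) (x y : R) : x = 1 -> y = 1 -> x * y = 1.
Proof. by move=> -> ->; rewrite mulr1. Qed.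

(** Being disjoint from this set means being proper, so [exists_prime_disjoint] puts a prime above a
    proper ideal. *)
Definition one_set (R : comPzRingType) : mul_set R :=
  @MulSet R (fun x => x = 1) erefl (@one_setM R).

Section McCoy.
Variables (R S : comPzRingType) (phi : {rmorphism R -> S}).
Hypothesis phi_semicontent : semicontent phi.

Lemma zero_divisor_content (I : ideal R) (p : prime_ideal R) f g a b s :
  content phi (f * g) `<=` I -> content phi f a -> content phi g b ->
  colon I b `<=` p ->
  zero_divisor (quot_proj (ideal_ext (loc_map (prime_compl p)) I) (mk_frac a s)).
Proof.
move=> fgI fa gb Ibp; have [_ _ locE] := phi_semicontent.
set K := ideal_ext (loc_map (prime_compl p)) I.
have {}locE := locE (powers_away_set p a) f g
  (ex_intro2 _ _ a (powers_away_mem p a) fa).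
have /ideal_ext_loc_map[_ [u [n [pu ->]]] /fgI Iw] :
    ideal_ext (loc_map (powers_away_set p a)) (content phi (f * g)) (loc_map _ b).
  by rewrite locE; apply: mem_ideal_gen; exists b.
have KP c : K (loc_map _ c) <-> exists2 v, ~ p v & I (v * c).
  exact: ideal_ext_loc_map.
have : K (loc_map _ (a ^+ n * b)) by apply/KP; exists u; rewrite ?mulrA.
(* Descend to the first power of [a] carrying [b] into [K]. It is not the zeroth, as [colon I b]
   lies in [p]; the preceding multiple of [b] is then nonzero modulo [K] and killed by [a]. *)
elim: n {Iw} => [|n IHn] Kn.
  move: Kn; rewrite mul1r => /KP[v pv Ivb]; case: pv; apply: Ibp.
  by rewrite /= mulrC.
have [/IHn//|nK] := pselect (K (loc_map _ (a ^+ n * b))).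
exists (quot_proj K (mk_frac (a ^+ n * b) (denom1 _))).
  by apply/eqP; rewrite quot_loc_eq0.
by rewrite -rmorphM mk_fracM quot_loc_eq0 mulrA -exprS.
Qed.

Lemma mccoy_quot (I : ideal R) :
  (forall p : prime_ideal R, fidel_A (loc_at p)) -> mccoy (quot_map phi I).
Proof.
move=> fidel; have [_ OR _] := phi_semicontent.
split; first exact: ohm_rush_quot.
elim/quot_ind=> f; elim/quot_ind=> g; rewrite -rmorphM => /quot_proj_eq0 fgI g0.
have {fgI} fgI : content phi (f * g) `<=` I by apply: content_sub.
have [b gb Ib] : exists2 b, content phi g b & ~ I b.
  apply: contrapT => noI; case/eqP: g0; apply/quot_proj_eq0.
  apply: ohm_rush_mem_ext => // b gb; apply: contrapT => Ib.
  by apply: noI; exists b.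
have [|p [Ibp _]] := @exists_prime_disjoint _ (colon I b) (one_set R).
  by move=> x Ibx x1; apply: Ib; move: Ibx; rewrite x1 /= mulr1.
set K := ideal_ext (loc_map (prime_compl p)) I.
have KP c : K (loc_map _ c) <-> exists2 v, ~ p v & I (v * c).
  exact: ideal_ext_loc_map.
have [t ct] := content_fin_gen f OR.
pose h a := quot_proj K (loc_map (prime_compl p) a).
(* Elements of this ideal are classes of fractions with numerator in c(f), hence zero-divisors by
   [zero_divisor_content]. *)
have [||r r0 Jr] := fidel p K (ideal_gen [set` map h t]); first by exists (map h t).
  move=> x Jx; have : ideal_gen (quot_proj K @` (loc_map (prime_compl p) @` [set` t])) x.
    apply: ideal_gen_mono Jx => _ /mapP[a ta ->].
    by exists (loc_map (prime_compl p) a) => //; exists a.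
  move=> /ideal_gen_image_surj[|_ /ideal_gen_loc_map[a [s [ta ->]]] <-].
    exact: quot_proj_surj.
  by apply: (zero_divisor_content _ fgI _ gb Ibp); rewrite ct.
elim/quot_loc_ind: r r0 Jr => c s /eqP c0 Jc.
(* Each generator needs its own multiplier outside [p]; the product of these finitely many serves
   for all. *)
have [v pv vt] : exists2 v, ~ p v & {in t, forall a, I (v * (a * c))}.
  have {ct} : {in t, forall a, exists2 v, ~ p v & I (v * (a * c))}.
    move=> a ta; apply/KP/(quot_loc_eq0 K _ (denomM (denom1 _) s)).
    by rewrite -mk_fracM rmorphM; apply: Jc; apply: mem_ideal_gen; apply: map_f.
  elim: t {Jc} => [|a t IHt] vt; first by exists 1 => //; apply: prime_compl1.
  have [|v pv {}IHt] := IHt; first by move=> e et; apply: vt; rewrite inE et orbT.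
  have [w pw Iw] := vt a (mem_head _ _).
  exists (w * v); first exact: prime_complM.
  move=> e; rewrite inE => /orP[/eqP->|/IHt Ie]; last by rewrite -mulrA; apply: idealMl.
  by rewrite (mulrC w) -mulrA; apply: idealMl.
(* If [v * c] were in [I], then [c] would vanish modulo [K], as [v] is outside [p]. *)
exists (quot_proj I (v * c)).
  apply/eqP => /quot_proj_eq0 Ivc; apply: c0; apply/quot_loc_eq0/KP.
  by exists v.
move=> _ /(content_quot_map OR)[a + <-]; rewrite ct => ta.
rewrite -rmorphM; apply/quot_proj_eq0.
apply: (@ideal_gen_sub _ _ (colon I (v * c)) _ _ ta) => e /vt.
by rewrite /= -mulrA (mulrC c).
Qed.

End McCoy.

Theorem theorem5 (R S : comPzRingType) (phi : {rmorphism R -> S}) :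
  (semicontent phi ->
   (forall p : prime_ideal R, fidel_A (loc_at p)) ->
   residually_mccoy phi)
  /\
  (locally_noetherian R \/ arithmetical R \/ has_krull_dim R 0
     \/ (is_domain R /\ has_krull_dim R 1) ->
   forall p : prime_ideal R, fidel_A (loc_at p)).
Proof.
split=> [sc fidel|cases p].
  by split=> [|I]; [case: sc|apply: mccoy_quot].
case: cases => [noeth|[arith|[dim0|[dom dim1]]]].
- exact/fidel_A_noetherian/noeth.
- exact/fidel_A_chain/arith.
- exact: fidel_A_dim0.
- exact: fidel_A_domain_dim1.
Qed.
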